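(* Let $d_{0,\Sigma}$ denote the distance of $(x_0+y_{1,0},\dots,x_0+y_{m,0})$ to the extended solution set $\mathcal S^*(\Sigma)$ (defined in the context) in which $T_i:=\nabla f_i+\partial\varphi_i$, for $i=1,\dots,m$, and let $\rho,\delta,\epsilon>0$ be given tolerances. Let $L_\Sigma:=\max\{L_i\}_{i=1}^m$. Then the parallel forward-backward splitting method described in the context finds: (a) $x_1,\dots,x_m\in\mathcal H$, $u_1,\dots,u_m\in\mathcal H$ and $\varepsilon_1,\dots,\varepsilon_m>0$ satisfying $$u_i\in(\partial_{\varepsilon_i}f_i+\partial\varphi_i)(x_i)\ \ \forall i=1,\dots,m,\quad \Big\|\sum_{i=1}^mu_i\Big\|\le\rho,\quad \|x_i-x_\ell\|\le\delta\ \ \forall i,\ell=1,\dots,m,\quad \sum_{i=1}^m\varepsilon_i\le\epsilon$$ in at most $$\mathcal O\left(\max\left\{\left\lceil\frac{m\,L_\Sigma^2\,d_{0,\Sigma}^2}{\rho^2}\right\rceil,\left\lceil\frac{d_{0,\Sigma}^2}{\delta^2}\right\rceil,\left\lceil\frac{L_\Sigma\,d_{0,\Sigma}^2}{\epsilon}\right\rceil\right\}\right)$$ iterations; (b) $x_1,\dots,x_m\in\mathcal H$, $u_1,\dots,u_m\in\mathcal H$, $\varepsilon_1,\dots,\varepsilon_m>0$ and $\hat\varepsilon_1,\dots,\hat\varepsilon_m>0$ such that $$u_i\in(\partial_{\varepsilon_i}f_i+\partial_{\hat\varepsilon_i}\varphi_i)(x_i)\ \ \forall i=1,\dots,m,\quad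 \Big\|\sum_{i=1}^mu_i\Big\|\le\rho,\quad \|x_i-x_\ell\|\le\delta\ \ \forall i,\ell=1,\dots,m,\quad \sum_{i=1}^m(\varepsilon_i+\hat\varepsilon_i)\le\epsilon$$ in at most $$\mathcal O\left(\max\left\{\left\lceil\frac{\sqrt m\,L_\Sigma\,d_{0,\Sigma}}{\rho}\right\rceil,\left\lceil\frac{d_{0,\Sigma}}{\delta}\right\rceil,\left\lceil\frac{L_\Sigma\,d_{0,\Sigma}^2}{\epsilon}\right\rceil\right\}\right)$$ iterations.
   Context: $\mathcal H$ is a real Hilbert space, $\overline{\mathbb R}=\mathbb R\cup\{\pm\infty\}$, $m\ge2$. The problem is $\min_{x\in\mathcal H}\sum_{i=1}^m(f_i+\varphi_i)(x)$ under these assumptions for all $i=1,\dots,m$: $f_i:\mathcal H\to\mathbb R$ is convex and differentiable with $\|\nabla f_i(x)-\nabla f_i(y)\|\le L_i\|x-y\|$ for all $x,y\in\mathcal H$, where $L_i>0$; $\varphi_i:\mathcal H\to\overline{\mathbb R}$ is proper, convex and closed, with an easily computable resolvent $(\lambda\partial\varphi_i+I)^{-1}$ for any $\lambda>0$; the solution set of the problem is nonempty; and the $\varphi_i$ satisfy standard regularity conditions making the minimization problem equivalent to finding $x$ with $0\in\sum_{i=1}^m(\nabla f_i+\partial\varphi_i)(x)$. Here $\partial_\varepsilon g(x)=\{v:\ g(y)\ge g(x)+\langle v,y-x\rangle-\varepsilon\ \forall y\}$ is the $\varepsilon$-subdifferential ($\varepsilon\ge0$) and $\partial g=\partial_0g$.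 $\mathcal H^m$ carries the inner product $\langle(x_i),(x_i')\rangle=\sum_{i=1}^m\langle x_i,x_i'\rangle$ and the induced norm. For maximal monotone $T_1,\dots,T_m$ on $\mathcal H$, the extended solution set of $0\in\sum_{i=1}^mT_i(x)$, assumed nonempty, is $$\mathcal S^*(\Sigma):=\Big\{(z_i)_{i=1}^m\in\mathcal H^m:\ \exists\,x,u_1,\dots,u_m\in\mathcal H,\ u_i\in T_i(x)\ \forall i,\ \sum_{i=1}^mu_i=0,\ z_i=x+u_i\ \forall i\Big\}.$$ Parallel forward-backward splitting method: given $(x_0,y_{1,0},\dots,y_{m,0})\in\mathcal H^{m+1}$ with $y_{1,0}+\dots+y_{m,0}=0$ and $\sigma\in\,]0,1[$, set $\lambda=\sigma^2/\max\{L_i\}_{i=1}^m$; for $k=1,2,\dots$ compute $$\tilde x_{i,k}=(\lambda\partial\varphi_i+I)^{-1}\big(x_{k-1}+y_{i,k-1}-\lambda\nabla f_i(x_{k-1})\big),\quad i=1,\dots,m,$$ and set $x_k=\frac1m\sum_{i=1}^m\tilde x_{i,k}$, $y_{i,k}=y_{i,k-1}+x_k-\tilde x_{i,k}$ for $i=1,\dots,m$. Quantities associated with the iterates, for $k\ge1$ and $i=1,\dots,m$: $u'_{i,k}:=\frac1\lambda(x_{k-1}+y_{i,k-1}-\tilde x_{i,k})$; $\ \varepsilon'_{i,k}:=f_i(\tilde x_{i,k})-f_i(x_{k-1})-\langle\nabla f_i(x_{k-1}),\tilde x_{i,k}-x_{k-1}\rangle$; and the ergodic means $\tilde x_{i,k}^a:=\frac1k\sum_{\ell=1}^k\tilde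 x_{i,\ell}$, $\ u'^{\,a}_{i,k}:=\frac1k\sum_{\ell=1}^ku'_{i,\ell}$.
   Formalization: As printed the bound fails: the uniform O-bound is proved with the distance to S*(Σ) for the operators λT_i instead of T_i; with the printed d_{0,Σ}>0 the O-constant may depend on the problem and starting point, not on the tolerances; at least one iteration is allowed when the distance is 0. *)

(* Defs.v *)
From HB Require Import structures.
From mathcomp Require Import all_boot all_order all_algebra.
From mathcomp Require Import all_classical all_reals all_analysis.

Set Implicit Arguments.
Unset Strict Implicit.
Unset Printing Implicit Defensive.

Import Order.TTheory GRing.Theory Num.Theory.
Import numFieldNormedType.Exports.

Local Open Scope classical_set_scope.
Local Open Scope ring_scope.

(* A real Hilbert space is a completeNormedModType over a realType together
   with a symmetric positive definite bilinear form [ip : {dot H for idfun}]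
   that induces its norm, [forall x, ip x x = `|x| ^+ 2]. *)

Section operators.
Context {R : realType} {H : lmodType R}.

Definition operator := H -> set H.

Definition op_fun (g : H -> H) : operator := fun x => [set g x].

Definition op_add (S T : operator) : operator :=
  fun x => [set w | exists u v, [/\ S x u, T x v & w = u + v]].

Definition op_scale (l : R) (T : operator) : operator :=
  fun x => [set l *: u | u in T x].

Definition op_inv (T : operator) : operator := fun v => [set x | T x v].

Definition op_sum (m : nat) (T : 'I_m -> operator) : operator :=
  fun x => [set w | exists u : 'I_m -> H,
    (forall i, T i x (u i)) /\ w = \sum_(i < m) u i].

Definition resolvent (l : R) (T : operator) : operator :=
  op_inv (op_add (op_scale l T) (op_fun id)).

(* The fixed points of the parallel forward-backward method with step size
   [lam] are the points x + y_i = x + lam *: u_i with u_i \in T_i x and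
   \sum_i u_i = 0, i.e., the extended solutions of the rescaled operators
   [op_scale lam (T i)], which differ from those of [T i] if [lam != 1]. *)
Definition extended_solutions (m : nat) (T : 'I_m -> operator) :
    set ('I_m -> H) :=
  [set z | exists (x : H) (u : 'I_m -> H),
    [/\ forall i, T i x (u i), \sum_(i < m) u i = 0
      & forall i, z i = x + u i]].

End operators.
Arguments operator {R} H.

Section convex_analysis.
Context {R : realType} {H : normedModType R}.
Variable ip : {dot H for idfun}.

Definition is_gradient (f : H -> R) (g : H -> H) : Prop :=
  forall x, differentiable (f : H -> R^o) x /\
    forall h, 'd (f : H -> R^o) x h = ip (g x) h.

Definition proper_fun (g : H -> \bar R) : Prop :=
  (forall x, -oo < g x)%E /\ exists x, (g x < +oo)%E.

(* For a proper [g] no undefined sum -oo + +oo occurs, and 0 * +oo = 0. *)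
Definition convex_efun (g : H -> \bar R) : Prop :=
  forall (t : R) (x y : H), 0 <= t <= 1 ->
    (g ((t *: x + (1 - t) *: y)%R) <= t%:E * g x + (1 - t)%:E * g y)%E.

Definition is_minimizer (g : H -> \bar R) (x : H) : Prop :=
  forall y, (g x <= g y)%E.

Definition esubdiff (e : R) (g : H -> \bar R) : operator H :=
  fun x => [set v | forall y, (g x + (ip v (y - x) - e)%:E <= g y)%E].

Definition prodH_norm (m : nat) (z : 'I_m -> H) : R :=
  Num.sqrt (\sum_(i < m) ip (z i) (z i)).

Definition prodH_dist (m : nat) (w : 'I_m -> H) (S : set ('I_m -> H)) : R :=
  inf [set prodH_norm (fun i => w i - z i) | z in S].

End convex_analysis.

Definition maxL {R : realType} (m : nat) (L : 'I_m -> R) : R :=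
  \big[Num.max/0]_(i < m) L i.

Section parallel_forward_backward.
Context {R : realType} {H : normedModType R}.
Variables (ip : {dot H for idfun}) (m : nat).
Variables (f : 'I_m -> H -> R) (df : 'I_m -> H -> H).
Variable (phi : 'I_m -> H -> \bar R).
Variable lam : R.
Variables (x : nat -> H) (y xt : nat -> 'I_m -> H).

Definition fb_op (i : 'I_m) : operator H :=
  op_add (op_fun (df i)) (esubdiff ip 0 (phi i)).

(* The resolvents are single valued, so that membership is equality.
   The value of [xt 0] is irrelevant. *)
Definition pfb_run : Prop :=
  \sum_(i < m) y 0%N i = 0 /\
  forall k : nat,
  [/\ forall i, resolvent lam (esubdiff ip 0 (phi i))
                  (x k + y k i - lam *: df i (x k)) (xt k.+1 i),
      x k.+1 = m%:R^-1 *: \sum_(i < m) xt k.+1 i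
    & forall i, y k.+1 i = y k i + x k.+1 - xt k.+1 i].

(* [uprime k i] and [epsprime k i] are meaningful for [0 < k] only. *)
Definition uprime (k : nat) (i : 'I_m) : H :=
  lam^-1 *: (x k.-1 + y k.-1 i - xt k i).

Definition epsprime (k : nat) (i : 'I_m) : R :=
  f i (xt k i) - f i (x k.-1) - ip (df i (x k.-1)) (xt k i - x k.-1).

Definition ergodic (s : nat -> 'I_m -> H) (k : nat) (i : 'I_m) : H :=
  k%:R^-1 *: \sum_(1 <= l < k.+1) s l i.

Definition pointwise_found (rho delta epsilon : R) (k : nat) : Prop :=
  exists eps : 'I_m -> R,
  [/\ forall i, 0 < eps i /\ epsprime k i <= eps i,
      forall i, op_add (esubdiff ip (eps i) (EFin \o f i))
                       (esubdiff ip 0 (phi i)) (xt k i) (uprime k i),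
      `|\sum_(i < m) uprime k i| <= rho,
      forall i l, `|xt k i - xt k l| <= delta
    & \sum_(i < m) eps i <= epsilon].

Definition ergodic_found (rho delta epsilon : R) (k : nat) : Prop :=
  exists eps epsh : 'I_m -> R,
  [/\ forall i, 0 < eps i /\ 0 < epsh i,
      forall i, op_add (esubdiff ip (eps i) (EFin \o f i))
                       (esubdiff ip (epsh i) (phi i))
                       (ergodic xt k i) (ergodic uprime k i),
      `|\sum_(i < m) ergodic uprime k i| <= rho,
      forall i l, `|ergodic xt k i - ergodic xt k l| <= delta
    & \sum_(i < m) (eps i + epsh i) <= epsilon].

End parallel_forward_backward.

Section complexity.
Context {R : realType}.

Definition rceil (r : R) : R := (Num.ceil r)%:~R.

(* The outer [Num.max 1] only matters if [d = 0], when the three integers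
   vanish although one iteration is needed to produce any output. *)
Definition pointwise_bound (m : nat) (L d rho delta epsilon : R) : R :=
  Num.max 1 (Num.max (Num.max (rceil (m%:R * L ^+ 2 * d ^+ 2 / rho ^+ 2))
                              (rceil (d ^+ 2 / delta ^+ 2)))
                     (rceil (L * d ^+ 2 / epsilon))).

Definition ergodic_bound (m : nat) (L d rho delta epsilon : R) : R :=
  Num.max 1 (Num.max (Num.max (rceil (Num.sqrt m%:R * L * d / rho))
                              (rceil (d / delta)))
                     (rceil (L * d ^+ 2 / epsilon))).

Definition found_within (N : R) (P : nat -> Prop) : Prop :=
  exists k : nat, [/\ (0 < k)%N, k%:R <= N & P k].

End complexity.

(* Main.v *)
Require Import Defs.
From HB Require Import structures.
From mathcomp Require Import all_boot all_order all_algebra.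
From mathcomp Require Import all_classical all_reals all_analysis.
From mathcomp Require Import ring lra.

Set Implicit Arguments.
Unset Strict Implicit.
Unset Printing Implicit Defensive.

Import Order.TTheory GRing.Theory Num.Theory.
Import numFieldNormedType.Exports.

Local Open Scope classical_set_scope.
Local Open Scope ring_scope.

(** The method is a partial inverse (Spingarn) iteration on H^m.  Write
    z_k = (x_k + y_{i,k})_i, p_k for the tuple of resolvent values and
    v_k = z_{k-1} - p_k, so that v_{i,k} is lam times u'_{i,k}.  Then
    z_k = P p_k + Q v_k, where P and Q are the orthogonal projections onto the
    diagonal of H^m and onto the tuples of sum zero, and for every w = a + b
    with a diagonal and b of sum zero, expanding squares gives
[[
      |z_{k-1} - w|^2 - |z_k - w|^2 = D_k + 2 <p_k - a, v_k - b>,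
      D_k = |Q p_k|^2 + |P v_k|^2 = |p_k - x_{k-1}|^2
]]
    ([pfb_step_identity]).  All the estimates come from this identity.

    If w is an extended solution, then u'_{i,k} and b_i / lam belong to an
    eps'-enlargement of T_i and to T_i, so monotonicity bounds the inner product
    below by - lam sum_i eps'_{i,k}.  The descent lemma and
    lam = sigma^2 / max L bound 2 lam sum_i eps'_{i,k} by sigma^2 D_k.  Hence
    z_k is Fejer monotone and (1 - sigma^2) sum_k D_k <= d^2 ([fejer]).

    Pointwise, some D_l with l <= k is at most d^2 / ((1 - sigma^2) k), and
    |sum_i u'_i|, |xt_i - xt_l| and sum_i eps'_i are all controlled by D_l.

    Ergodically, telescoping turns the sums of the xt_i and of the u'_i into
    coordinates of z_0 - z_k, of norm at most 2 d, which gives the rate d / k.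
    The transportation formula ([esubdiff_mean]) gives the ergodic means as
    approximate subgradients, and the total error is a mean of the inner
    products <p_l - p^a, u'_l> and of the eps'.  The step identity with w the
    mean of z_1, ..., z_k bounds it by 2 d^2 / (lam k) ([ergodic_cross]).

    These bounds hold with d the distance to the extended solutions of the
    rescaled operators lam T_i.  Any other positive number d' satisfies
    d <= r d' for some r >= 1, and replacing d by d' costs a factor r^2 in the
    number of iterations; this covers the distance to the extended solutions of
    the T_i themselves. *)

(** * Integer iteration bounds *)

Section iteration_bounds.
Context {R : realType}.

Lemma int_max (a b : R) :
  a \is a Num.int -> b \is a Num.int -> Num.max a b \is a Num.int.
Proof. by move=> ai bi; case: leP. Qed.

Lemma rceil_int (r : R) : rceil r \is a Num.int.
Proof. exact: intr_int. Qed.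

(** Both complexity bounds have this shape.  Being a positive integer, such a
    bound times a natural number is itself an admissible iteration count. *)
Lemma max_rceil_nat (t1 t2 t3 : R) :
  let B := Num.max 1 (Num.max (Num.max (rceil t1) (rceil t2)) (rceil t3)) in
  exists n : nat, [/\ B = n%:R, (0 < n)%N, t1 <= n%:R, t2 <= n%:R & t3 <= n%:R].
Proof.
move=> B.
have Bint : B \is a Num.int.
  by apply: int_max; rewrite ?int1//; do 2?apply: int_max; exact: rceil_int.
have B1 : 1 <= B by rewrite /B le_max lexx.
have [n Bn] : exists n : nat, B = n%:R.
  by apply/natrP; rewrite natrEint Bint (le_trans ler01).
exists n; rewrite -Bn; split=> //.
- by rewrite -(ltr_nat R) -Bn (lt_le_trans ltr01).
- by rewrite (le_trans (ceil_ge t1))// /B !le_max lexx ?orbT.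
- by rewrite (le_trans (ceil_ge t2))// /B !le_max lexx ?orbT.
- by rewrite (le_trans (ceil_ge t3))// /B !le_max lexx ?orbT.
Qed.

Lemma sum_nat_ord (V : zmodType) (F : nat -> V) k :
  \sum_(1 <= l < k.+1) F l = \sum_(l < k) F l.+1.
Proof. by rewrite big_add1/= big_mkord. Qed.

End iteration_bounds.

(** * Inner products, gradients of convex functions *)

Section inner_product.
Context {R : realType} {H : normedModType R}.
Variable ip : {dot H for idfun}.
Hypothesis ip_norm : forall x : H, ip x x = `|x| ^+ 2.

Lemma ipDl x y z : ip (x + y) z = ip x z + ip y z.
Proof. exact: linearDl. Qed.

Lemma ipDr x y z : ip x (y + z) = ip x y + ip x z.
Proof. exact: linearDr. Qed.

Lemma ipNl x y : ip (- x) y = - ip x y.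
Proof. exact: linearNl. Qed.

Lemma ipNr x y : ip x (- y) = - ip x y.
Proof. exact: linearNr. Qed.

Lemma ipBl x y z : ip (x - y) z = ip x z - ip y z.
Proof. by rewrite ipDl ipNl. Qed.

Lemma ipBr x y z : ip x (y - z) = ip x y - ip x z.
Proof. by rewrite ipDr ipNr. Qed.

Lemma ipZl a x y : ip (a *: x) y = a * ip x y.
Proof. exact: linearZl_LR. Qed.

Lemma ipZr a x y : ip x (a *: y) = a * ip x y.
Proof. exact: linearZr_LR. Qed.

Lemma ipC x y : ip x y = ip y x.
Proof. by rewrite (hermC ip) expr0 mul1r. Qed.

Lemma ip_suml I (s : seq I) (P : pred I) (F : I -> H) y :
  ip (\sum_(i <- s | P i) F i) y = \sum_(i <- s | P i) ip (F i) y.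
Proof. exact: linear_sumlz. Qed.

Lemma ip_sumr I (s : seq I) (P : pred I) (F : I -> H) x :
  ip x (\sum_(i <- s | P i) F i) = \sum_(i <- s | P i) ip x (F i).
Proof. exact: linear_sumr. Qed.

Lemma ip_ge0 x : 0 <= ip x x.
Proof. by rewrite ip_norm exprn_ge0. Qed.

Lemma cauchy_schwarz x y : ip x y <= `|x| * `|y|.
Proof.
have := ip_ge0 (`|y| *: x - `|x| *: y).
rewrite !(ipBl, ipBr, ipZl, ipZr) (ipC y x) !ip_norm => h.
have [->|x0] := eqVneq x 0; first by rewrite -(scale0r 0) ipZl normrZ normr0 !mul0r.
have [->|y0] := eqVneq y 0; first by
  rewrite -(scale0r 0) ipZr normrZ normr0 !(mul0r, mulr0).
have xy0 : 0 < `|x| * `|y| by rewrite mulr_gt0 ?normr_gt0.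
rewrite -(ler_pM2l xy0); nra.
Qed.

Lemma sqr_norm_le x c : 0 <= c -> ip x x <= c ^+ 2 -> `|x| <= c.
Proof. by move=> c0; rewrite ip_norm ler_pXn2r ?nnegrE. Qed.

End inner_product.

Section gradient.
Context {R : realType} {H : normedModType R}.
Variable ip : {dot H for idfun}.
Hypothesis ip_norm : forall x : H, ip x x = `|x| ^+ 2.

Lemma EFin_proper (g : H -> R) : proper_fun (EFin \o g).
Proof. by split=> [w|]; [exact: ltNyr|exists 0; exact: ltry]. Qed.

Lemma convex_function_efun (f : H -> R) :
  convex_function [set: convex_lmodType H] f -> convex_efun (EFin \o f).
Proof.
move=> cf t x y /andP[t0 t1] /=.
rewrite -!EFinM -EFinD lee_fin.
have := cf (Itv01 t0 t1) x y.
by rewrite !in_setT => /(_ isT isT).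
Qed.

(** Restriction to a line, which reduces the descent lemma to one variable. *)
Lemma gradient_is_derive (f : H -> R) g (x h : H) (t : R) : is_gradient ip f g ->
  is_derive t 1 (fun s : R => f (s *: h + x)) (ip (g (t *: h + x)) h).
Proof.
move=> fg.
have [df dfE] := fg (t *: h + x).
have [dv <-] : is_derive (t *: h + x) h (f : H -> R^o) (ip (g (t *: h + x)) h).
  by split; [exact: diff_derivable|rewrite deriveE].
have E : (fun s : R => s^-1 *: (((fun s : R => f (s *: h + x)) \o shift t) (s *: 1)
      - f (t *: h + x))) =
    (fun s : R => s^-1 *: (((f : H -> R^o) \o shift (t *: h + x)) (s *: h)
      - f (t *: h + x))).
  apply/funext => s /=; congr (_ *: (f _ - _)).
  have -> : s *: (1 : R^o) = s by exact: mulr1.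
  by rewrite scalerDl addrA.
by split; rewrite /derivable /derive /= E.
Qed.

(** Along the segment from x to y the difference of the two sides is a function
    of one variable that vanishes at 0 and whose derivative is nonpositive by
    Cauchy-Schwarz and the Lipschitz condition; conclude by the mean value
    theorem. *)
Lemma descent_lemma (f : H -> R) g (L : R) (x y : H) :
  is_gradient ip f g -> 0 <= L -> (forall x y, `|g x - g y| <= L * `|x - y|) ->
  f y - f x - ip (g x) (y - x) <= L / 2 * `|y - x| ^+ 2.
Proof.
move=> fg L0 gL; set h := y - x.
pose c t := ip (g (t *: h + x)) h - ip (g x) h - L * t * `|h| ^+ 2.
pose k t := f (t *: h + x) - t * ip (g x) h - L / 2 * t ^+ 2 * `|h| ^+ 2.
have dk (t : R) : is_derive t 1 k (c t).
  have df := gradient_is_derive x h t fg.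
  have -> : k = (fun s => f (s *: h + x)) - (fun s => s * ip (g x) h)
     - (fun s => L / 2 * s ^+ 2 * `|h| ^+ 2).
    by apply/funext => s.
  apply: is_derive_eq.
  by rewrite /c /GRing.scale /=; field.
have ck : {within `[0, 1], continuous k}.
  by apply: derivable_within_continuous => t _; have [] := dk t.
have [t /[!in_itv]/= /andP[t0 _]] := MVT ltr01 (fun t _ => dk t) ck.
rewrite subr0 mulr1 /k !(scale1r, scale0r, add0r) {1}/h subrK => kE.
suff : c t <= 0 by move: kE; nra.
rewrite /c -ipBl subr_le0.
apply: (le_trans (cauchy_schwarz ip_norm _ _)).
rewrite expr2 mulrA ler_wpM2r//.
apply: (le_trans (gL _ _)).
by rewrite addrK normrZ (gtr0_norm t0) mulrA.
Qed.

(** Convexity makes the slope of f between x and x + t (y - x) at most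
    f y - f x for t in ]0, 1]; let t tend to 0 from the right. *)
Lemma gradient_esubdiff (f : H -> R) g :
  is_gradient ip f g -> convex_efun (EFin \o f) ->
  forall x, esubdiff ip 0 (EFin \o f) x (g x).
Proof.
move=> fg cf x y /=.
rewrite -EFinD lee_fin subr0 -lerBrDl.
have [df <-] := fg x.
rewrite -deriveE//.
have dv := diff_derivable (v := y - x) df.
apply: (cvgr_to_le (cvg_dnbhs_at_right dv)).
near=> t.
have t0 : 0 < t by near: t; exact: nbhs_right_gt.
have t1 : t <= 1 by near: t; exact: nbhs_right_le.
have := cf t y x; rewrite (ltW t0) t1 => /(_ isT) /=.
have -> : t *: y + (1 - t) *: x = t *: (y - x) + x.
  by rewrite scalerBr scalerBl scale1r addrA addrAC.
rewrite -!EFinM -EFinD lee_fin => h.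
rewrite /GRing.scale /= mulrC ler_pdivrMr//.
by move: h; lra.
Unshelve. all: by end_near. Qed.

End gradient.

(** * Calculus of approximate subdifferentials *)

Section subdifferential.
Context {R : realType} {H : normedModType R}.
Variable ip : {dot H for idfun}.
Variable g : H -> \bar R.
Hypothesis g_proper : proper_fun g.

(** Properness excludes the value +oo wherever a subgradient exists, so that
    everything below can be computed with real numbers. *)
Lemma esubdiff_fin_num e x v : esubdiff ip e g x v -> g x \is a fin_num.
Proof.
have [gNy [y gy]] := g_proper => /(_ y) h.
rewrite fin_numE gt_eqF ?gNy//=; apply: contraTneq h => ->.
by rewrite addye// -ltNge.
Qed.

Lemma esubdiff_of_fine e x v : g x \is a fin_num ->
  (forall y, g y \is a fin_num -> fine (g x) + ip v (y - x) - e <= fine (g y)) ->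
  esubdiff ip e g x v.
Proof.
move=> gx h y.
have [gNy _] := g_proper.
have [gy|] := boolP (g y \is a fin_num).
  by rewrite -(fineK gx) -(fineK gy) -EFinD lee_fin addrA h.
by rewrite fin_numE gt_eqF ?gNy//= negbK => /eqP ->; rewrite leey.
Qed.

Lemma esubdiff_fine e x v y : esubdiff ip e g x v -> g y \is a fin_num ->
  fine (g x) + ip v (y - x) - e <= fine (g y).
Proof.
move=> vx gy; have := vx y.
by rewrite -(fineK (esubdiff_fin_num vx)) -{1}(fineK gy) -EFinD lee_fin addrA.
Qed.

Lemma esubdiff_mono e e' x v : e <= e' ->
  esubdiff ip e g x v -> esubdiff ip e' g x v.
Proof.
move=> ee' vx; apply: esubdiff_of_fine (esubdiff_fin_num vx) _ => y gy.
by have := esubdiff_fine vx gy; lra.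
Qed.

(** A subgradient at one point remains an approximate subgradient at any other
    point of the domain; the error is the linearization gap. *)
Lemma esubdiff_transport x x' v e : g x' \is a fin_num -> esubdiff ip e g x v ->
  esubdiff ip (e + fine (g x') - fine (g x) - ip v (x' - x)) g x' v.
Proof.
move=> gx' vx; apply: esubdiff_of_fine => // y gy.
by have := esubdiff_fine vx gy; rewrite !(ipBr ip); lra.
Qed.

(** Add the two subgradient inequalities, each taken at the other point. *)
Lemma esubdiff_monotone e e' x x' v v' :
  esubdiff ip e g x v -> esubdiff ip e' g x' v' ->
  - (e + e') <= ip (v - v') (x - x').
Proof.
move=> vx vx'.
have := esubdiff_fine vx (esubdiff_fin_num vx').
have := esubdiff_fine vx' (esubdiff_fin_num vx).
by rewrite !(ipBr ip, ipBl ip); lra.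
Qed.

End subdifferential.

Section mean.
Context {R : realType} {V : lmodType R}.

(** The indices start at 1 because the iterates entering the ergodic means do;
    [ergodic s k i] is convertible to [mean (s^~ i) k]. *)
Definition mean (a : nat -> V) k := k%:R^-1 *: \sum_(1 <= l < k.+1) a l.

Lemma scale_mean (a : nat -> V) k : (0 < k)%N ->
  k%:R *: mean a k = \sum_(1 <= l < k.+1) a l.
Proof. by move=> k0; rewrite scalerA divff ?scale1r// pnatr_eq0 -lt0n. Qed.

Lemma mean1 a : mean a 1 = a 1%N.
Proof. by rewrite /mean big_nat1 invr1 scale1r. Qed.

(** A mean of k + 1 terms is a convex combination of the mean of the first k
    and the last one, which allows Jensen by induction. *)
Lemma meanS a k : (0 < k)%N ->
  mean a k.+1 = (k%:R / k.+1%:R) *: mean a k + (1 - k%:R / k.+1%:R) *: a k.+1.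
Proof.
move=> k0; rewrite {1}/mean big_nat_recr//= scalerDr -scale_mean// scalerA mulrC.
have -> // : 1 - k%:R / k.+1%:R = k.+1%:R^-1 :> R.
by rewrite -natr1; field; rewrite natr1 pnatr_eq0.
Qed.

End mean.

Section transportation.
Context {R : realType} {H : normedModType R}.
Variable ip : {dot H for idfun}.
Variable g : H -> \bar R.
Hypotheses (g_proper : proper_fun g) (g_convex : convex_efun g).

Lemma convex_mean (x : nat -> H) k : (0 < k)%N ->
  (forall l, (0 < l)%N -> g (x l) \is a fin_num) ->
  (g (mean x k) <= (mean (fun l => fine (g (x l)) : R^o) k)%:E)%E.
Proof.
move=> + gx; elim: k => // -[_ _|k IH _]; first by rewrite !mean1 fineK ?gx.
rewrite !(meanS _ (ltn0Sn k)).
set t := k.+1%:R / k.+2%:R.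
have t01 : 0 <= t <= 1 by rewrite divr_ge0//= ler_pdivrMr// mul1r ler_nat.
apply: le_trans (g_convex _ _ t01) _.
rewrite -[X in (_ + _ * X)%E]fineK ?gx// -EFinM.
apply: (@le_trans _ _ (t * mean (fun l => fine (g (x l)) : R^o) k.+1
    + (1 - t) * fine (g (x k.+2)))%:E); last exact: lexx.
rewrite EFinD; apply: leeD2r; rewrite (EFinM t); apply: lee_wpmul2l; last exact: IH.
by rewrite lee_fin; case/andP: t01.
Qed.

(** The transportation formula: average the subgradient inequalities of the
    x l and use Jensen at their mean.  The error is nonnegative because the
    averaged inequality can be tested at the mean itself. *)
Lemma esubdiff_mean (x v : nat -> H) (e : nat -> R) k :
  let eps := mean (fun l => e l + ip (v l) (x l - mean x k) : R^o) k in
  (0 < k)%N -> (forall l, (0 < l)%N -> esubdiff ip (e l) g (x l) (v l)) ->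
  esubdiff ip eps g (mean x k) (mean v k) /\ 0 <= eps.
Proof.
move=> eps k0 vx.
have gx l : (0 < l)%N -> g (x l) \is a fin_num.
  by move=> l0; exact: esubdiff_fin_num (vx _ l0).
have gm := convex_mean k0 gx.
have gmf : g (mean x k) \is a fin_num.
  by rewrite fin_numE gt_eqF ?(g_proper.1)//= lt_eqF// (le_lt_trans gm) ?ltry.
rewrite -(fineK gmf) lee_fin in gm.
have k1 : 0 < k%:R :> R by rewrite ltr0n.
have sub y : g y \is a fin_num ->
    fine (g (mean x k)) + ip (mean v k) (y - mean x k) - eps <= fine (g y).
  move=> gy; apply: (@le_trans _ _ (mean (fun l => fine (g (x l)) : R^o) k
      + ip (mean v k) (y - mean x k) - eps)); first by rewrite lerD2r lerD2r.
  rewrite -(ler_pM2l k1) mulrBr mulrDr -(ipZl ip) scale_mean//.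
  rewrite -![_%:R * mean _ _]/(_%:R *: mean _ _) !scale_mean// (ip_suml ip).
  rewrite -big_split/= -sumrB mulr_natl.
  have -> : fine (g y) *+ k = \sum_(1 <= l < k.+1) fine (g y).
    by rewrite sumr_const_nat subn1.
  rewrite !big_nat; apply: ler_sum => l /andP[l0 _].
  have := esubdiff_fine g_proper (vx l l0) gy.
  by rewrite !(ipBr ip); lra.
split; first exact: esubdiff_of_fine.
by have := sub _ gmf; rewrite (ipBr ip); lra.
Qed.

End transportation.

(** * The product space *)

Section product_space.
Context {R : realType} {H : normedModType R}.
Variable ip : {dot H for idfun}.
Hypothesis ip_norm : forall x : H, ip x x = `|x| ^+ 2.

Definition sqnorm m (w : 'I_m -> H) : R := \sum_(i < m) ip (w i) (w i).

Lemma sqnorm_ge0 m (w : 'I_m -> H) : 0 <= sqnorm w.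
Proof. by apply: sumr_ge0 => i _; exact: ip_ge0. Qed.

Lemma sqnorm_coord m (w : 'I_m -> H) i : ip (w i) (w i) <= sqnorm w.
Proof.
rewrite /sqnorm (bigD1 i)//= lerDl.
by apply: sumr_ge0 => j _; exact: ip_ge0.
Qed.

Lemma ip_sub_le a b : ip (a - b) (a - b) <= 2 * ip a a + 2 * ip b b.
Proof.
have := ip_ge0 ip_norm (a + b).
by rewrite !(ipBl ip, ipBr ip, ipDl ip, ipDr ip) (ipC ip b a); lra.
Qed.

(** The pointwise part of the step identity.  The cross terms in the last line
    disappear after summation over the coordinates when q and b have sum zero
    and a and e do not depend on the coordinate. *)
Lemma ip_exchange q a e b :
  ip (q + a + (e + b)) (q + a + (e + b)) = ip (a + b) (a + b)
    + (ip q q + ip e e) + 2 * ip (q + a) (e + b)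
    + 2 * (ip a q + ip e b - ip a b).
Proof.
rewrite !(ipDl ip, ipDr ip) (ipC ip q a) (ipC ip e a) (ipC ip b a).
by rewrite (ipC ip e q) (ipC ip b q) (ipC ip b e); ring.
Qed.

Lemma sqnorm_sub_le m (a b : 'I_m -> H) :
  sqnorm (fun i => a i - b i) <= 2 * sqnorm a + 2 * sqnorm b.
Proof.
by rewrite /sqnorm !mulr_sumr -big_split; apply: ler_sum => i _; exact: ip_sub_le.
Qed.

(** Pythagoras: the diagonal is orthogonal to the tuples of sum zero. *)
Lemma sqnorm_diagD m (a : H) (b : 'I_m -> H) : \sum_(i < m) b i = 0 ->
  sqnorm (fun i => a + b i) = m%:R * ip a a + sqnorm b.
Proof.
move=> b0; rewrite /sqnorm.
under eq_bigr do rewrite !(ipDl ip, ipDr ip) (ipC ip _ a) addrA.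
have ab0 : \sum_(i < m) ip a (b i) = 0.
  by rewrite -(ip_sumr ip) b0 -(scale0r 0) (ipZr ip) mul0r.
by rewrite !big_split/= ab0 !addr0 sumr_const card_ord mulr_natl.
Qed.

(** Jensen for the squared norm: the difference of the two sides is the sum of
    the squared deviations from the mean. *)
Lemma ip_mean_le (a : nat -> H) k : (0 < k)%N ->
  k%:R * ip (mean a k) (mean a k) <= \sum_(1 <= l < k.+1) ip (a l) (a l).
Proof.
move=> k0; rewrite -subr_ge0.
have : 0 <= \sum_(1 <= l < k.+1) ip (a l - mean a k) (a l - mean a k).
  by apply: sumr_ge0 => l _; exact: ip_ge0.
have sm : \sum_(1 <= l < k.+1) ip (mean a k) (a l) = k%:R * ip (mean a k) (mean a k).
  by rewrite -(ip_sumr ip) -(scale_mean _ k0) (ipZr ip).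
under eq_bigr do rewrite (ipBl ip) !(ipBr ip) (ipC ip _ (mean a k)).
by rewrite !sumrB sm sumr_const_nat subn1/= -(mulr_natl (ip _ _)) subrr subr0.
Qed.

(** Changing the reference points from (pm, 0) to (a, b) in a sum of inner
    products.  When pm is the mean of the p l, the correction involves only the
    mean of p and the sum of v, and in [ergodic_cross] it vanishes after
    summation over the coordinates. *)
Lemma ip_mean_shift (p v : nat -> H) pm a b k : k%:R *: pm = \sum_(l < k) p l ->
  \sum_(l < k) ip (p l - a) (v l - b) = \sum_(l < k) ip (p l - pm) (v l)
    + ip (pm - a) (\sum_(l < k) v l - k%:R *: b).
Proof.
move=> pmE.
have E l : ip (p l - a) (v l - b) = ip (p l - pm) (v l) + ip (pm - a) (v l)
    - ip (p l) b + ip a b.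
  by rewrite !(ipBl ip, ipBr ip); ring.
under eq_bigr do rewrite E.
rewrite !(big_split, sumrB)/= -!addrA; congr (_ + _).
rewrite (ipBr ip) (ip_sumr ip); congr (_ + _).
rewrite sumrN; have -> : \sum_(l < k) ip (p l) b = k%:R * ip pm b.
  by rewrite -(ip_suml ip) -pmE (ipZl ip).
by rewrite sumr_const card_ord -(mulr_natl (ip _ _)) (ipZr ip) (ipBl ip); ring.
Qed.

Lemma sqnorm_mean_le m (a : nat -> 'I_m -> H) k M : (0 < k)%N ->
  (forall l, sqnorm (a l) <= M) -> sqnorm (fun i => mean (a^~ i) k) <= M.
Proof.
move=> k0 aM; have k1 : 0 < k%:R :> R by rewrite ltr0n.
rewrite -(ler_pM2l k1) mulr_sumr.
apply: (@le_trans _ _ (\sum_(1 <= l < k.+1) sqnorm (a l))).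
  by rewrite exchange_big/=; apply: ler_sum => i _; exact: ip_mean_le.
have -> : k%:R * M = \sum_(1 <= l < k.+1) M.
  by rewrite sumr_const_nat subn1 mulr_natl.
exact: ler_sum.
Qed.

(** An estimate valid for each point of S passes to the infimum, whether or not
    it is attained. *)
Lemma le_sqr_prodH_dist m (w : 'I_m -> H) (S : set ('I_m -> H)) X :
  S !=set0 -> (forall z, S z -> X <= sqnorm (fun i => w i - z i)) ->
  X <= prodH_dist ip w S ^+ 2.
Proof.
move=> [z0 Sz0] SX.
have [X0|X0] := leP X 0; first exact: (le_trans X0 (sqr_ge0 _)).
rewrite -[leLHS]sqr_sqrtr ?(ltW X0)// ler_pXn2r ?nnegrE ?sqrtr_ge0//.
  apply: lb_le_inf; first by exists (prodH_norm ip (fun i => w i - z0 i)), z0.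
  by move=> _ [z Sz <-]; rewrite ler_sqrt ?SX// sqnorm_ge0.
apply: lb_le_inf; first by exists (prodH_norm ip (fun i => w i - z0 i)), z0.
by move=> _ [z Sz <-]; rewrite sqrtr_ge0.
Qed.

Lemma prodH_dist_ge0 m (w : 'I_m -> H) (S : set ('I_m -> H)) :
  0 <= prodH_dist ip w S.
Proof.
have [->|/set0P[z0 Sz0]] := eqVneq S set0.
  by rewrite /prodH_dist image_set0 inf0.
apply: lb_le_inf; first by exists (prodH_norm ip (fun i => w i - z0 i)), z0.
by move=> _ [z Sz <-]; rewrite sqrtr_ge0.
Qed.

End product_space.

(** * The iterates of the method *)

Section method.
Context {R : realType} {H : normedModType R}.
Variable ip : {dot H for idfun}.
Hypothesis ip_norm : forall x : H, ip x x = `|x| ^+ 2.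
Variables (m : nat) (f : 'I_m -> H -> R) (df : 'I_m -> H -> H).
Variables (phi : 'I_m -> H -> \bar R) (L s lam : R).
Hypotheses (m_gt0 : (0 < m)%N) (L_gt0 : 0 < L).
Hypothesis f_convex : forall i, convex_efun (EFin \o f i).
Hypothesis f_grad : forall i, is_gradient ip (f i) (df i).
Hypothesis df_lip : forall i x y, `|df i x - df i y| <= L * `|x - y|.
Hypothesis phi_proper : forall i, proper_fun (phi i).
Hypothesis phi_convex : forall i, convex_efun (phi i).
Hypotheses (s_gt0 : 0 < s) (s_lt1 : s < 1) (lamE : lam = s / L).
Variables (x : nat -> H) (y xt : nat -> 'I_m -> H).
Hypothesis run : pfb_run ip df phi lam x y xt.

(* The data of the step from iterate k to iterate k + 1 are indexed by k. *)
Let u k i := uprime lam x y xt k.+1 i.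
Let eps k i := epsprime ip f df x xt k.+1 i.
Let z k i := x k + y k i.

Let mR : m%:R != 0 :> R.
Proof. by rewrite pnatr_eq0 -lt0n. Qed.

Lemma lam_gt0 : 0 < lam.
Proof. by rewrite lamE divr_gt0. Qed.

Lemma sum_xt k : \sum_(i < m) xt k.+1 i = m%:R *: x k.+1.
Proof.
by have [_ /(_ k)[_ -> _]] := run; rewrite scalerA divff// scale1r.
Qed.

Lemma sum_y k : \sum_(i < m) y k i = 0.
Proof.
elim: k => [|k IH]; first by case: run.
have [_ /(_ k)[_ _ yS]] := run.
under eq_bigr do rewrite yS -addrA.
by rewrite big_split/= IH sumrB sum_xt sumr_const card_ord scaler_nat subrr add0r.
Qed.

(** In terms of the projections P and Q, the three equalities [sum_y],
    [sum_xt_sub] and [scale_u] say z_{k+1} = P p + Q v. *)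
Lemma sum_xt_sub k : \sum_(i < m) (xt k.+1 i - x k.+1) = 0.
Proof. by rewrite sumrB sum_xt sumr_const card_ord scaler_nat subrr. Qed.

Lemma scale_u k i : lam *: u k i = y k.+1 i + (x k - x k.+1).
Proof.
rewrite /u /uprime /= scalerA divff ?gt_eqF ?lam_gt0// scale1r.
have [_ /(_ k)[_ _ ->]] := run.
by rewrite [RHS]addrC -!addrA [- x k.+1 + (_ + _)]addrCA addKr.
Qed.

Lemma phi_esubdiff k i : esubdiff ip 0 (phi i) (xt k.+1 i) (u k i - df i (x k)).
Proof.
have [_ /(_ k)[/(_ i) [_ [_ [[v vphi <-] -> e]]] _ _]] := run.
suff -> : u k i - df i (x k) = v by [].
have l0 : lam != 0 by rewrite gt_eqF// lam_gt0.
apply: (scalerI l0); rewrite scalerBr /u /uprime scalerA divff// scale1r /=.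
by rewrite addrAC e addrK.
Qed.

(** The gradient is taken at x k but used at xt k.+1 i: [epsprime] is exactly
    the linearization gap of [esubdiff_transport]. *)
Lemma f_esubdiff k i :
  esubdiff ip (eps k i) (EFin \o f i) (xt k.+1 i) (df i (x k)).
Proof.
have -> : eps k i = 0 + f i (xt k.+1 i) - f i (x k)
    - ip (df i (x k)) (xt k.+1 i - x k) by rewrite add0r.
by apply: (esubdiff_transport (EFin_proper _)) => //; exact: gradient_esubdiff.
Qed.

Lemma eps_ge0 k i : 0 <= eps k i.
Proof.
have := gradient_esubdiff (f_grad i) (f_convex i) (x k) (xt k.+1 i).
by rewrite /= -EFinD lee_fin /eps /epsprime /=; lra.
Qed.

(** |Q p|^2 + |P v|^2, the quantity called D_k in the introduction. *)
Let residual k :=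
  sqnorm ip (fun i => xt k.+1 i - x k.+1) + m%:R * ip (x k - x k.+1) (x k - x k.+1).

Lemma residual_ge0 k : 0 <= residual k.
Proof. by rewrite addr_ge0 ?mulr_ge0 ?sqnorm_ge0 ?ip_ge0. Qed.

Lemma residualE k : residual k = sqnorm ip (fun i => xt k.+1 i - x k).
Proof.
rewrite /residual -(opprB (x k.+1)) !(ipNl ip, ipNr ip) opprK addrC.
rewrite -(sqnorm_diagD ip (x k.+1 - x k) (sum_xt_sub k)).
by apply: eq_bigr => i _; rewrite [_ - x k + _]addrC subrKA.
Qed.

(** This is where the step size enters: the descent lemma has the constant
    L / 2, and lam L = s. *)
Lemma sum_eps_le k : 2 * lam * \sum_(i < m) eps k i <= s * residual k.
Proof.
rewrite residualE [s * _]mulr_sumr mulr_sumr; apply: ler_sum => i _.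
have := descent_lemma ip_norm (x k) (xt k.+1 i) (f_grad i) (ltW L_gt0) (@df_lip i).
rewrite -[f i _ - _ - _]/(eps k i) -ip_norm => /(ler_wpM2l (ltW lam_gt0)) h.
by rewrite -mulrA (le_trans (ler_wpM2l _ h))// lamE le_eqVlt; apply/orP; left;
  apply/eqP; field; rewrite gt_eqF.
Qed.

(** With q = Q p, e = P v, al = P p - a and be = Q v - b, this is the sum over
    the coordinates of [ip_exchange]. *)
Lemma pfb_step_identity k a (b : 'I_m -> H) : \sum_(i < m) b i = 0 ->
  sqnorm ip (fun i => z k i - (a + b i)) = sqnorm ip (fun i => z k.+1 i - (a + b i))
    + residual k + 2 * \sum_(i < m) ip (xt k.+1 i - a) (lam *: u k i - b i).
Proof.
move=> b0.
pose q i := xt k.+1 i - x k.+1; pose al := x k.+1 - a.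
pose e := x k - x k.+1; pose be i := y k.+1 i - b i.
have E1 i : xt k.+1 i - a = q i + al by rewrite /q /al subrKA.
have E2 i : lam *: u k i - b i = e + be i.
  by rewrite scale_u addrAC addrC.
have E3 i : z k.+1 i - (a + b i) = al + be i by rewrite opprD addrACA.
have E4 i : z k i - (a + b i) = q i + al + (e + be i).
  rewrite -E1 -E2 addrACA -opprD; congr (_ - _).
  by rewrite /u /uprime scalerA divff ?gt_eqF ?lam_gt0// scale1r addrC subrK.
have q0 : \sum_(i < m) ip al (q i) = 0.
  by rewrite -(ip_sumr ip) sum_xt_sub -(scale0r 0) (ipZr ip) mul0r.
have be0 c : \sum_(i < m) ip c (be i) = 0.
  by rewrite -(ip_sumr ip) sumrB sum_y b0 subrr -(scale0r 0) (ipZr ip) mul0r.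
rewrite /residual /sqnorm -/e.
have key i : ip (z k i - (a + b i)) (z k i - (a + b i)) =
    ip (z k.+1 i - (a + b i)) (z k.+1 i - (a + b i)) + (ip (q i) (q i) + ip e e)
    + 2 * ip (xt k.+1 i - a) (lam *: u k i - b i)
    + 2 * (ip al (q i) + ip e (be i) - ip al (be i)).
  by rewrite E1 E2 E3 E4; exact: ip_exchange.
rewrite (eq_bigr _ (fun i _ => key i)) !big_split/= -!mulr_sumr sumrB big_split/=.
by rewrite q0 !be0 !(addr0, subr0, mulr0) sumr_const card_ord mulr_natl.
Qed.

Let sol := extended_solutions (fun i => op_scale lam (fb_op ip df phi i)).

Lemma fb_op_monotone k i a w : fb_op ip df phi i a w ->
  - eps k i <= ip (xt k.+1 i - a) (u k i - w).
Proof.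
move=> [_ [v [-> va ->]]].
have := esubdiff_monotone (phi_proper i) (phi_esubdiff k i) va.
have := esubdiff_monotone (EFin_proper (f i)) (f_esubdiff k i)
  (gradient_esubdiff (f_grad i) (f_convex i) a).
by rewrite !(ipBl ip, ipBr ip, ipDl ip, ipDr ip) !(ipC ip _ (xt _ _)) !(ipC ip _ a);
  lra.
Qed.

Lemma fejer k zs : sol zs ->
  sqnorm ip (fun i => z k.+1 i - zs i) + (1 - s) * residual k
    <= sqnorm ip (fun i => z k i - zs i).
Proof.
move=> [a [b [bT b0 zsE]]].
have -> : zs = fun i => a + b i by apply/funext.
rewrite (pfb_step_identity k a b0).
suff : - (lam * \sum_(i < m) eps k i) <=
    \sum_(i < m) ip (xt k.+1 i - a) (lam *: u k i - b i).
  by have := sum_eps_le k; lra.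
rewrite mulr_sumr -sumrN; apply: ler_sum => i _.
have [w wT <-] := bT i.
by rewrite -scalerBr (ipZr ip) -mulrN ler_pM2l ?lam_gt0// fb_op_monotone.
Qed.

Lemma fejer_sum k zs : sol zs ->
  sqnorm ip (fun i => z k i - zs i) + (1 - s) * \sum_(l < k) residual l
    <= sqnorm ip (fun i => z 0 i - zs i).
Proof.
move=> zs_sol; elim: k => [|k IH]; first by rewrite big_ord0 mulr0 addr0.
by rewrite big_ord_recr/=; have := fejer k zs_sol; move: IH; lra.
Qed.

Hypothesis sol_neq0 : sol !=set0.
Let d := prodH_dist ip (z 0) sol.

Lemma sum_residual_le k : (1 - s) * \sum_(l < k) residual l <= d ^+ 2.
Proof.
apply: (le_sqr_prodH_dist ip_norm sol_neq0) => zs zs_sol.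
apply: le_trans (fejer_sum k zs_sol); rewrite lerDr; exact: sqnorm_ge0.
Qed.

(** By Fejer monotonicity z k is no farther than z 0 from any extended solution;
    the factor 4 is the square of 2 in |z 0 - z k| <= 2 d. *)
Lemma sqnorm_drift_le k : sqnorm ip (fun i => z 0 i - z k i) <= 4 * d ^+ 2.
Proof.
rewrite mulrC -ler_pdivrMr//; apply: (le_sqr_prodH_dist ip_norm sol_neq0) => zs zs_sol.
rewrite ler_pdivrMr//.
have -> : (fun i => z 0 i - z k i) = (fun i => (z 0 i - zs i) - (z k i - zs i)).
  by apply/funext => i; rewrite opprB addrA subrK.
apply: le_trans (sqnorm_sub_le ip_norm _ _) _.
have := fejer_sum k zs_sol.
have : 0 <= (1 - s) * \sum_(l < k) residual l.
  by rewrite mulr_ge0 ?subr_ge0 ?(ltW s_lt1)// sumr_ge0// => l _; exact: residual_ge0.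
by lra.
Qed.

Lemma drift_split k : sqnorm ip (fun i => z 0 i - z k i) =
  m%:R * ip (x 0 - x k) (x 0 - x k) + sqnorm ip (fun i => y 0 i - y k i).
Proof.
rewrite -[RHS](@sqnorm_diagD _ _ ip); last by rewrite sumrB !sum_y subrr.
by apply: eq_bigr => i _; rewrite /z opprD addrACA.
Qed.

(** The smallest of k residuals is at most their average. *)
Lemma exists_small_residual k : (0 < k)%N ->
  exists2 l, (l < k)%N & k%:R * ((1 - s) * residual l) <= d ^+ 2.
Proof.
move=> k0; apply: contrapT => nl.
suff : d ^+ 2 < (1 - s) * \sum_(l < k) residual l.
  by rewrite ltNge sum_residual_le.
have k1 : 0 < k%:R :> R by rewrite ltr0n.
rewrite -(ltr_pM2l k1) 2!mulr_sumr.
have -> : k%:R * d ^+ 2 = \sum_(l < k) d ^+ 2.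
  by rewrite sumr_const card_ord mulr_natl.
apply: ltr_sum => [|l _].
  by apply/hasP; exists (Ordinal k0); rewrite ?mem_index_enum.
by rewrite ltNge; apply/negP => h; apply: nl; exists l.
Qed.

Lemma sum_u k : lam *: \sum_(i < m) u k i = m%:R *: (x k - x k.+1).
Proof.
rewrite scaler_sumr; under eq_bigr do rewrite scale_u.
by rewrite big_split/= sum_y add0r sumr_const card_ord -scaler_nat.
Qed.

Lemma sum_u_norm k : lam ^+ 2 * `|\sum_(i < m) u k i| ^+ 2 <= m%:R * residual k.
Proof.
rewrite -[lam in leLHS]gtr0_norm ?lam_gt0// -exprMn -normrZ sum_u -ip_norm.
by rewrite (ipZl ip) (ipZr ip) ler_wpM2l// lerDr; exact: sqnorm_ge0.
Qed.

Lemma xt_dist k i j : `|xt k.+1 i - xt k.+1 j| ^+ 2 <= 4 * residual k.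
Proof.
have -> : xt k.+1 i - xt k.+1 j = (xt k.+1 i - x k.+1) - (xt k.+1 j - x k.+1).
  by rewrite opprB addrA subrK.
rewrite -ip_norm.
apply: le_trans (ip_sub_le ip_norm _ _) _.
have h i0 : ip (xt k.+1 i0 - x k.+1) (xt k.+1 i0 - x k.+1) <= residual k.
  apply: le_trans (sqnorm_coord ip_norm (fun i => xt k.+1 i - x k.+1) i0) _.
  by rewrite lerDl mulr_ge0// ip_ge0.
by have := h i; have := h j; lra.
Qed.

Lemma pointwise_mem k i e : eps k i <= e ->
  op_add (esubdiff ip e (EFin \o f i)) (esubdiff ip 0 (phi i)) (xt k.+1 i) (u k i).
Proof.
move=> ee; exists (df i (x k)), (u k i - df i (x k)); split.
- exact: (esubdiff_mono (EFin_proper _) ee (f_esubdiff _ _)).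
- exact: phi_esubdiff.
- by rewrite addrC subrK.
Qed.

(** The increments of y telescope, which produces the factor 1 / k in the
    ergodic rates. *)
Lemma sum_xt_iterates k i :
  \sum_(l < k) xt l.+1 i = \sum_(l < k) x l.+1 + (y 0 i - y k i).
Proof.
elim: k => [|k IH]; first by rewrite !big_ord0 subrr addr0.
rewrite !big_ord_recr/= IH; have [_ /(_ k)[_ _ ->]] := run.
by rewrite -!addrA; congr (_ + _); rewrite !opprD opprK [RHS]addrCA;
  congr (_ + _); rewrite [RHS]addrCA; congr (_ + _); rewrite addrA subrr add0r.
Qed.

Lemma sum_u_iterates k i :
  \sum_(l < k) (lam *: u l i) = \sum_(l < k) y l.+1 i + (x 0 - x k).
Proof.
elim: k => [|k IH]; first by rewrite !big_ord0 subrr addr0.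
by rewrite !big_ord_recr/= IH scale_u addrACA subrKA.
Qed.

Lemma scale_ergodic (a : nat -> 'I_m -> H) k i : (0 < k)%N ->
  k%:R *: ergodic a k i = \sum_(l < k) a l.+1 i.
Proof. by move=> k0; rewrite -(sum_nat_ord (a^~ i)) (scale_mean (a^~ i)). Qed.

Lemma ergodic_xt_dist k i j :
  (0 < k)%N -> k%:R * `|ergodic xt k i - ergodic xt k j| <= 4 * d.
Proof.
move=> k0; rewrite -[k%:R]normr_nat -normrZ scalerBr !scale_ergodic//.
rewrite !sum_xt_iterates opprD addrACA subrr add0r.
have d0 : 0 <= d by exact: prodH_dist_ge0.
have h i0 : `|y 0 i0 - y k i0| <= 2 * d.
  apply: (sqr_norm_le ip_norm); first by rewrite mulr_ge0.
  apply: le_trans (sqnorm_coord ip_norm (fun i => y 0 i - y k i) i0) _.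
  rewrite exprMn -natrX; apply: le_trans (sqnorm_drift_le k).
  by rewrite drift_split lerDr mulr_ge0// ip_ge0.
by apply: le_trans (ler_normB _ _) _; have := h i; have := h j; lra.
Qed.

Lemma ergodic_u_norm k : (0 < k)%N ->
  k%:R * lam * `|\sum_(i < m) ergodic (uprime lam x y xt) k i|
    <= 2 * Num.sqrt m%:R * d.
Proof.
move=> k0.
have d0 : 0 <= d by exact: prodH_dist_ge0.
have kl0 : 0 <= k%:R * lam by rewrite mulr_ge0// ltW// lam_gt0.
rewrite -[k%:R * lam in leLHS]ger0_norm// -normrZ [k%:R * lam]mulrC -scalerA.
apply: (sqr_norm_le ip_norm); first by rewrite !mulr_ge0.
have -> : lam *: (k%:R *: \sum_(i < m) ergodic (uprime lam x y xt) k i)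
    = m%:R *: (x 0 - x k).
  rewrite scaler_sumr; under eq_bigr do rewrite scale_ergodic//.
  rewrite scaler_sumr; under eq_bigr do rewrite scaler_sumr sum_u_iterates.
  rewrite big_split/= sumr_const card_ord -scaler_nat exchange_big/=.
  by rewrite big1 ?add0r// => l _; exact: sum_y.
rewrite (ipZl ip) (ipZr ip) !exprMn sqr_sqrtr//.
have -> : 2 ^+ 2 * m%:R * d ^+ 2 = m%:R * (4 * d ^+ 2) by ring.
rewrite ler_wpM2l//.
apply: le_trans (sqnorm_drift_le k).
by rewrite drift_split lerDl; exact: sqnorm_ge0.
Qed.

(** The step identity is summed over the iterations, with w the mean of
    z_1, ..., z_k, which splits as a + b with a the mean of the x's and b that
    of the y's.  The reference point (a, b) can then be replaced by
    (ergodic xt, 0): coordinatewise the difference is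
    <ergodic xt - a, x_0 - x_k>, whose second factor does not depend on the
    coordinate while the first has sum zero. *)
Lemma ergodic_cross k : (0 < k)%N ->
  2 * \sum_(l < k) \sum_(i < m) ip (xt l.+1 i - ergodic xt k i) (lam *: u l i)
    + \sum_(l < k) residual l <= 4 * d ^+ 2.
Proof.
move=> k0.
pose a := mean x k; pose b i := mean (y^~ i) k.
have ka : k%:R *: a = \sum_(l < k) x l.+1 by rewrite scale_mean// sum_nat_ord.
have kb i : k%:R *: b i = \sum_(l < k) y l.+1 i by rewrite scale_mean// sum_nat_ord.
have kR : k%:R != 0 :> R by rewrite pnatr_eq0 -lt0n.
have b0 : \sum_(i < m) b i = 0.
  apply: (scalerI kR); rewrite scaler0 scaler_sumr.
  under eq_bigr do rewrite kb.
  by rewrite exchange_big/= big1// => l _; exact: sum_y.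
have -> : \sum_(l < k) \sum_(i < m) ip (xt l.+1 i - ergodic xt k i) (lam *: u l i)
    = \sum_(l < k) \sum_(i < m) ip (xt l.+1 i - a) (lam *: u l i - b i).
  rewrite exchange_big [RHS]exchange_big/=.
  under [RHS]eq_bigr => i _ do rewrite (@ip_mean_shift _ _ ip (fun l => xt l.+1 i)
    (fun l => lam *: u l i) _ a (b i) _ (scale_ergodic xt i k0)) sum_u_iterates kb
    [_ + (x 0 - _)]addrC addrK.
  rewrite big_split/= -(ip_suml ip) [X in ip X _](_ : _ = 0) ?(linear0l ip) ?addr0//.
  apply: (scalerI kR); rewrite scaler0 sumrB scalerBr scaler_sumr.
  under eq_bigr do rewrite (scale_ergodic _ _ k0) sum_xt_iterates.
  rewrite big_split/= sumrB !sum_y subrr addr0.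
  by rewrite !sumr_const card_ord -scalerMnr ka subrr.
have tele n : sqnorm ip (fun i => z 0 i - (a + b i)) =
    sqnorm ip (fun i => z n i - (a + b i)) + \sum_(l < n) residual l
    + 2 * \sum_(l < n) \sum_(i < m) ip (xt l.+1 i - a) (lam *: u l i - b i).
  elim: n => [|n IH]; first by rewrite !big_ord0 mulr0 !addr0.
  by rewrite !big_ord_recr/= IH (pfb_step_identity n a b0); ring.
have wd : sqnorm ip (fun i => z 0 i - (a + b i)) <= 4 * d ^+ 2.
  have -> : (fun i => z 0 i - (a + b i)) =
      (fun i => mean (fun l => z 0 i - z l i) k).
    apply/funext => i; apply: (scalerI kR).
    rewrite scale_mean// sum_nat_ord sumrB sumr_const card_ord big_split/=.
    by rewrite scalerBr [_ *: (a + _)]scalerDr ka kb scaler_nat.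
  by apply: (sqnorm_mean_le ip_norm k0) => l; exact: sqnorm_drift_le.
have := sqnorm_ge0 ip_norm (fun i => z k i - (a + b i)).
by move: (tele k) wd; lra.
Qed.

(** The transportation formula is applied to f i and phi i separately.  The
    sum of the two errors only involves [epsprime] and the inner products of
    u with xt - ergodic xt, which [sum_eps_le] and [ergodic_cross] bound. *)
Lemma ergodic_mem k : (0 < k)%N -> exists e eh : 'I_m -> R,
  [/\ forall i, 0 <= e i /\ 0 <= eh i,
      forall i e' eh', e i <= e' -> eh i <= eh' ->
        op_add (esubdiff ip e' (EFin \o f i)) (esubdiff ip eh' (phi i))
          (ergodic xt k i) (ergodic (uprime lam x y xt) k i)
    & k%:R * lam * \sum_(i < m) (e i + eh i) <= 2 * d ^+ 2].
Proof.
move=> k0.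
have kR : k%:R != 0 :> R by rewrite pnatr_eq0 -lt0n.
pose pm := ergodic xt k.
pose e i : R := mean (fun l => epsprime ip f df x xt l i
  + ip (df i (x l.-1)) (xt l i - pm i) : R^o) k.
pose eh i : R := mean (fun l => 0
  + ip (uprime lam x y xt l i - df i (x l.-1)) (xt l i - pm i) : R^o) k.
have fe i := @esubdiff_mean _ _ ip _ (EFin_proper (f i)) (f_convex i)
  (xt^~ i) (fun l => df i (x l.-1)) (fun l => epsprime ip f df x xt l i) k k0.
have phie i := @esubdiff_mean _ _ ip _ (phi_proper i) (@phi_convex i)
  (xt^~ i) (fun l => uprime lam x y xt l i - df i (x l.-1)) (fun=> 0) k k0.
have {}fe i : esubdiff ip (e i) (EFin \o f i) (pm i)
    (mean (fun l => df i (x l.-1)) k) /\ 0 <= e i.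
  by apply: fe => -[//|l] _; exact: f_esubdiff.
have {}phie i : esubdiff ip (eh i) (phi i) (pm i)
    (mean (fun l => uprime lam x y xt l i - df i (x l.-1)) k) /\ 0 <= eh i.
  by apply: phie => -[//|l] _; exact: phi_esubdiff.
exists e, eh; split.
- by move=> i; have [_ ?] := fe i; have [_ ?] := phie i.
- move=> i e' eh' ee' eeh'.
  exists (mean (fun l => df i (x l.-1)) k),
    (mean (fun l => uprime lam x y xt l i - df i (x l.-1)) k); split.
  + exact: (esubdiff_mono (EFin_proper _) ee' (fe i).1).
  + exact: (esubdiff_mono (phi_proper i) eeh' (phie i).1).
  + apply: (scalerI kR); rewrite scalerDr !scale_mean// -big_split/=.
    apply: eq_bigr => l _.
    by rewrite addrC subrK.
- have E i : k%:R * lam * (e i + eh i) = lam * \sum_(l < k) eps l i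
      + \sum_(l < k) ip (xt l.+1 i - pm i) (lam *: u l i).
    rewrite mulrAC mulrDr -![k%:R * _]/(k%:R *: (_ : R^o)) !scale_mean//.
    rewrite -big_split/= sum_nat_ord mulr_suml mulr_sumr -big_split/=.
    apply: eq_bigr => l _; rewrite add0r (ipZr ip) (ipBl ip) -/(u l i) -/(eps l i).
    by rewrite (ipC ip _ (u l i)); ring.
  rewrite mulr_sumr (eq_bigr _ (fun i _ => E i)) big_split/= -mulr_sumr.
  rewrite exchange_big [X in _ + X]exchange_big/=.
  have cross := ergodic_cross k0.
  have le_eps : 2 * (lam * \sum_(l < k) \sum_(i < m) eps l i)
      <= \sum_(l < k) residual l.
    rewrite mulrA mulr_sumr; apply: ler_sum => l _.
    apply: le_trans (sum_eps_le l) _.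
    by rewrite ler_piMl ?residual_ge0 ?(ltW s_lt1).
  by move: cross le_eps; rewrite -/pm; lra.
Qed.

(* Only r and s constrain the constant c, so that it is uniform over all problems
   when r = 1. *)
Variables (r d' : R) (c : nat).
Hypotheses (r_ge1 : 1 <= r) (d_le : d <= r * d').
Hypothesis c_ge : 4 * r ^+ 2 <= c%:R * (s ^+ 2 * (1 - s)).

(* The choice of c yields the premise 4 q <= c' w, where w cancels the powers of
   s that enter the estimates through 1 / lam = L / s. *)
Let cancel_rate (c' w q N X Z : R) : 0 < q -> 4 * q <= c' * w -> 0 <= w ->
  0 <= N * X -> (c' * N) * X <= q * Z -> 4 * (N * X) <= w * Z.
Proof.
move=> q0 cw w0 NX h; rewrite -(ler_pM2l q0).
have := ler_wpM2l w0 h.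
have := ler_wpM2r NX cw.
by lra.
Qed.

Let r2_gt0 : 0 < r ^+ 2.
Proof. by rewrite exprn_gt0// (lt_le_trans ltr01). Qed.

Let d_ge0 : 0 <= d.
Proof. exact: prodH_dist_ge0. Qed.

Let d'_ge0 : 0 <= d'.
Proof. by rewrite -(pmulr_rge0 _ (lt_le_trans ltr01 r_ge1)) (le_trans d_ge0). Qed.

Let d2_le : d ^+ 2 <= r ^+ 2 * d' ^+ 2.
Proof. by rewrite -exprMn ler_pXn2r ?nnegrE// mulr_ge0// (le_trans ler01). Qed.

Let d_le2 : d <= r ^+ 2 * d'.
Proof.
apply: (le_trans d_le); rewrite ler_wpM2r// expr2 ler_peMl//.
exact: le_trans r_ge1.
Qed.

Let c_ge_s : 4 * r ^+ 2 <= c%:R * s.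
Proof.
apply: (le_trans c_ge); rewrite ler_wpM2l// expr2 -mulrA ler_piMr ?(ltW s_gt0)//.
by rewrite mulr_ile1 ?(ltW s_gt0) ?(ltW s_lt1)// ?subr_ge0 ?(ltW s_lt1)//
  gerBl ltW.
Qed.

Let c_gt0 : (0 < c)%N.
Proof.
rewrite lt0n; apply: contraTneq c_ge => ->.
by rewrite mul0r -ltNge mulr_gt0.
Qed.

Let Llam : L * lam = s.
Proof. by rewrite lamE mulrC divfK// gt_eqF. Qed.

Let L_lam w : L * (lam * w) = s * w.
Proof. by rewrite mulrA Llam. Qed.

Lemma pointwise_found_within rho delta epsilon :
  0 < rho -> 0 < delta -> 0 < epsilon ->
  found_within (c%:R * pointwise_bound m L d' rho delta epsilon)
    (pointwise_found ip f df phi lam x y xt rho delta epsilon).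
Proof.
move=> rho0 delta0 epsilon0; rewrite /pointwise_bound.
have [N [-> N0]] := max_rceil_nat (m%:R * L ^+ 2 * d' ^+ 2 / rho ^+ 2)
  (d' ^+ 2 / delta ^+ 2) (L * d' ^+ 2 / epsilon).
rewrite !ler_pdivrMr ?exprn_gt0// => Nrho Ndelta Neps.
have N1 : 0 < N%:R :> R by rewrite ltr0n.
have cN0 : (0 < c * N)%N by rewrite muln_gt0 c_gt0.
have [l lN] := exists_small_residual cN0.
set res := residual l => /le_trans /(_ d2_le) h.
have res0 : 0 <= res by exact: residual_ge0.
have {h} resN : 4 * (N%:R * res) <= s ^+ 2 * d' ^+ 2.
  apply: (@cancel_rate (c%:R * (1 - s)) _ (r ^+ 2)) => //.
  - by rewrite -mulrA [_ * s ^+ 2]mulrC.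
  - exact: sqr_ge0.
  - by rewrite mulr_ge0.
  - by apply: le_trans h; rewrite natrM le_eqVlt; apply/orP; left; apply/eqP; ring.
have s2 : s ^+ 2 <= 1 by rewrite expr_le1 ?ltW.
have sd : s ^+ 2 * d' ^+ 2 <= d' ^+ 2 by rewrite ler_piMl// sqr_ge0.
exists l.+1; split=> //; first by rewrite -natrM ler_nat.
have m1 : 0 < m%:R :> R by rewrite ltr0n.
(* Half of the budget [epsilon] makes the errors strictly positive. *)
exists (fun i => eps l i + epsilon / (2 * m%:R)).
have epsm : 0 < epsilon / (2 * m%:R) by rewrite divr_gt0// mulr_gt0.
split.
- by move=> i; rewrite ltr_wpDl ?eps_ge0// lerDl ltW.
- by move=> i; apply: pointwise_mem; rewrite lerDl ltW.
- rewrite -(@ler_pXn2r _ 2)// ?nnegrE ?(ltW rho0)//.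
  have Ns : 0 < N%:R * s ^+ 2 by rewrite mulr_gt0// exprn_gt0.
  rewrite -(ler_pM2l Ns).
  have L2 : 0 <= L ^+ 2 by rewrite sqr_ge0.
  have mL : 0 <= m%:R * L ^+ 2 by rewrite mulr_ge0.
  have := ler_wpM2l L2 (sum_u_norm l).
  rewrite mulrA -exprMn Llam -/res => /(ler_wpM2l (ltW N1)) h1.
  have h2 := ler_wpM2l mL resN.
  have h3 := ler_wpM2l (sqr_ge0 s) Nrho.
  have h4 : 0 <= s ^+ 2 * (m%:R * L ^+ 2 * d' ^+ 2).
    by rewrite mulr_ge0 ?sqr_ge0// mulr_ge0 ?sqr_ge0.
  move: h1 h2 h3 h4; rewrite -[\sum_(i < m) _]/(\sum_(i < m) u l i).
  by set U := `|_|; lra.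
- move=> i j; rewrite -(@ler_pXn2r _ 2)// ?nnegrE ?(ltW delta0)// -(ler_pM2l N1).
  have := ler_wpM2l (ltW N1) (xt_dist l i j).
  by rewrite -/res; lra.
- rewrite big_split/= sumr_const card_ord -(mulr_natl (epsilon / _)).
  have -> : m%:R * (epsilon / (2 * m%:R)) = epsilon / 2.
    by field; rewrite gt_eqF.
  have := ler_wpM2l (ltW L_gt0) (sum_eps_le l).
  rewrite -mulrA mulrCA L_lam -/res => h.
  have {}h : 2 * \sum_(i < m) eps l i <= L * res.
    by rewrite -(ler_pM2l s_gt0); move: h; lra.
  suff : 2 * \sum_(i < m) eps l i <= epsilon by lra.
  rewrite -(ler_pM2l N1).
  have := ler_wpM2l (ltW N1) h.
  have := ler_wpM2l (ltW L_gt0) (le_trans resN sd).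
  have : 0 <= L * d' ^+ 2 by rewrite mulr_ge0 ?sqr_ge0// ltW.
  by lra.
Qed.

Lemma ergodic_found_within rho delta epsilon :
  0 < rho -> 0 < delta -> 0 < epsilon ->
  found_within (c%:R * ergodic_bound m L d' rho delta epsilon)
    (ergodic_found ip f phi lam x y xt rho delta epsilon).
Proof.
move=> rho0 delta0 epsilon0; rewrite /ergodic_bound.
have [N [-> N0]] := max_rceil_nat (Num.sqrt m%:R * L * d' / rho)
  (d' / delta) (L * d' ^+ 2 / epsilon).
rewrite !ler_pdivrMr// => Nrho Ndelta Neps.
have N1 : 0 < N%:R :> R by rewrite ltr0n.
have cN0 : (0 < c * N)%N by rewrite muln_gt0 c_gt0.
have m1 : 0 < m%:R :> R by rewrite ltr0n.
have rate X Z : 0 <= X -> (c * N)%:R * X <= r ^+ 2 * Z ->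
    4 * (N%:R * X) <= s * Z.
  move=> X0; rewrite natrM => h.
  by apply: (@cancel_rate c%:R _ (r ^+ 2)) => //; [exact: ltW|rewrite mulr_ge0].
exists (c * N)%N; split=> //; first by rewrite natrM.
have [e [eh [e0 emem esum]]] := ergodic_mem cN0.
have epsm : 0 < epsilon / (4 * m%:R) by rewrite divr_gt0// mulr_gt0.
(* As before, half of the budget makes the 2 m errors strictly positive. *)
exists (fun i => e i + epsilon / (4 * m%:R)), (fun i => eh i + epsilon / (4 * m%:R)).
split.
- by move=> i; have [? ?] := e0 i; split; rewrite ltr_wpDl.
- by move=> i; apply: emem; rewrite lerDl ltW.
- set U := `|_|.
  have : 4 * (N%:R * (lam * U)) <= s * (2 * Num.sqrt m%:R * d').
    apply: rate; first by rewrite mulr_ge0 ?normr_ge0// ltW// lam_gt0.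
    rewrite mulrA; apply: le_trans (ergodic_u_norm cN0) _.
    by rewrite [leRHS]mulrCA ler_wpM2l// mulr_ge0// sqrtr_ge0.
  move=> /(ler_wpM2l (ltW L_gt0)).
  rewrite [L * _]mulrCA [L * _]mulrCA L_lam [N%:R * _]mulrCA [4 * _]mulrCA.
  rewrite [L * (s * _)]mulrCA ler_pM2l// => h.
  have mLd : 0 <= Num.sqrt m%:R * L * d' by rewrite !mulr_ge0 ?sqrtr_ge0// ltW.
  by rewrite -(ler_pM2l N1); move: h; lra.
- move=> i j; set U := `|_|.
  have : 4 * (N%:R * U) <= s * (4 * d').
    apply: rate (normr_ge0 _) _; apply: le_trans (ergodic_xt_dist i j cN0) _.
    by rewrite [leRHS]mulrCA ler_wpM2l.
  have : s * (4 * d') <= 4 * d' by rewrite ler_piMl ?mulr_ge0// ltW.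
  by move=> h1 h2; rewrite -(ler_pM2l N1); lra.
- have -> : \sum_(i < m) (e i + epsilon / (4 * m%:R) + (eh i + epsilon / (4 * m%:R)))
      = \sum_(i < m) (e i + eh i) + epsilon / 2.
    under eq_bigr do rewrite addrACA.
    rewrite big_split/= sumr_const card_ord -(mulr_natl (_ + _)).
    congr (_ + _).
    by field; rewrite gt_eqF.
  set E := \sum_(i < m) _ in esum *.
  have E0 : 0 <= E by apply: sumr_ge0 => i _; have [? ?] := e0 i; exact: addr_ge0.
  have : 4 * (N%:R * (lam * E)) <= s * (2 * d' ^+ 2).
    apply: rate; first by rewrite mulr_ge0// ltW// lam_gt0.
    apply: (@le_trans _ _ (2 * d ^+ 2)); first by rewrite mulrA.
    by rewrite [leRHS]mulrCA ler_wpM2l.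
  move=> /(ler_wpM2l (ltW L_gt0)).
  rewrite [L * _]mulrCA [L * _]mulrCA L_lam [N%:R * _]mulrCA [4 * _]mulrCA.
  rewrite [L * (s * _)]mulrCA ler_pM2l// => h.
  suff : E <= epsilon / 2 by lra.
  by rewrite -(ler_pM2l N1); move: h; lra.
Qed.

End method.

(** * Complexity *)

Lemma le_maxL (R : realType) m (L : 'I_m -> R) i : L i <= maxL L.
Proof. exact: le_bigmax_cond. Qed.

Theorem theorem4p5 (R : realType) (sigma : R) (sigma01 : 0 < sigma < 1) :
  exists2 C : R, 0 < C &
  forall (H : completeNormedModType R) (ip : {dot H for idfun})
    (ip_norm : forall x : H, ip x x = `|x| ^+ 2)
    (m : nat) (m_ge2 : (2 <= m)%N)
    (f : 'I_m -> H -> R) (df : 'I_m -> H -> H)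
    (phi : 'I_m -> H -> \bar R) (L : 'I_m -> R)
    (L_gt0 : forall i, 0 < L i)
    (f_convex : forall i, convex_function [set: convex_lmodType H] (f i))
    (f_grad : forall i, is_gradient ip (f i) (df i))
    (df_lip : forall i x y, `|df i x - df i y| <= L i * `|x - y|)
    (phi_proper : forall i, proper_fun (phi i))
    (phi_convex : forall i, convex_efun (phi i))
    (phi_closed : forall i, lower_semicontinuous (phi i)),
  let obj := fun x : H => (\sum_(i < m) ((f i x)%:E + phi i x))%E in
  forall (sol_nonempty : exists x, is_minimizer obj x)
    (regularity : forall x, is_minimizer obj x <-> op_sum (fb_op ip df phi) x 0),
  let Lmax := maxL L in
  let lam := sigma ^+ 2 / Lmax in
  forall (x : nat -> H) (y xt : nat -> 'I_m -> H)
    (run : pfb_run ip df phi lam x y xt),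
  let z0 := fun i : 'I_m => x 0%N + y 0%N i in
  let complexity := fun (K d : R) =>
    forall rho delta epsilon : R, 0 < rho -> 0 < delta -> 0 < epsilon ->
      found_within (K * pointwise_bound m Lmax d rho delta epsilon)
        (pointwise_found ip f df phi lam x y xt rho delta epsilon) /\
      found_within (K * ergodic_bound m Lmax d rho delta epsilon)
        (ergodic_found ip f phi lam x y xt rho delta epsilon) in
  let d_lam := prodH_dist ip z0
    (extended_solutions (fun i => op_scale lam (fb_op ip df phi i))) in
  let d_0 := prodH_dist ip z0 (extended_solutions (fb_op ip df phi)) in
  complexity C d_lam /\ (0 < d_0 -> exists2 K : R, 0 < K & complexity K d_0).
Proof.
case/andP: sigma01 => sigma0 sigma1.
have s0 : 0 < sigma ^+ 2 by rewrite exprn_gt0.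
have s1 : sigma ^+ 2 < 1 by rewrite expr_lt1// ltW.
pose w := (sigma ^+ 2) ^+ 2 * (1 - sigma ^+ 2).
have w0 : 0 < w by rewrite mulr_gt0 ?exprn_gt0// subr_gt0.
pose cst (r : R) := Num.bound (4 * r ^+ 2 / w).
have cstP r : 4 * r ^+ 2 <= (cst r)%:R * w.
  by rewrite -ler_pdivrMr// ltW// archi_boundP// divr_ge0 ?(ltW w0)// mulr_ge0// sqr_ge0.
have cst_gt0 r : 1 <= r -> 0 < (cst r)%:R :> R.
  move=> r1; rewrite -(pmulr_lgt0 _ w0) (lt_le_trans _ (cstP r))//.
  by rewrite mulr_gt0// exprn_gt0// (lt_le_trans ltr01).
exists (cst 1)%:R; first exact: cst_gt0.
move=> H ip ip_norm m m_ge2 f df phi L L_gt0 f_convex f_grad df_lip phi_proper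
  phi_convex _ obj sol_nonempty regularity Lmax lam x y xt run z0 complexity
  d_lam d_0.
have m_gt0 : (0 < m)%N by exact: ltn_trans m_ge2.
have Lmax_gt0 : 0 < Lmax := lt_le_trans (L_gt0 (Ordinal m_gt0)) (le_maxL L _).
have f_cvx i : convex_efun (EFin \o f i) by exact: convex_function_efun.
have f_lip i a b : `|df i a - df i b| <= Lmax * `|a - b|.
  by apply: le_trans (df_lip i a b) _; rewrite ler_wpM2r ?le_maxL.
have sol_neq0 :
    extended_solutions (fun i => op_scale lam (fb_op ip df phi i)) !=set0.
  have [a /regularity[v [va v0]]] := sol_nonempty.
  exists (fun i => a + lam *: v i), a, (fun i => lam *: v i); split=> //.
    by move=> i; exists (v i).
  by rewrite -scaler_sumr -v0 scaler0.
have found r d : 1 <= r -> d_lam <= r * d -> complexity (cst r)%:R d.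
  move=> r1 dr rho delta epsilon rho0 delta0 epsilon0; split.
    exact: (pointwise_found_within ip_norm m_gt0 Lmax_gt0 f_cvx f_grad f_lip
      phi_proper s0 s1 erefl run sol_neq0 r1 dr (cstP r)).
  exact: (ergodic_found_within ip_norm m_gt0 Lmax_gt0 f_cvx f_grad f_lip
    phi_proper phi_convex s0 s1 erefl run sol_neq0 r1 dr (cstP r)).
split=> [|d_0_gt0]; first by apply: found; rewrite ?mul1r.
pose r := Num.max 1 (d_lam / d_0).
have r1 : 1 <= r by rewrite le_max lexx.
exists (cst r)%:R; first exact: cst_gt0.
by apply: found => //; rewrite -ler_pdivrMr// le_max lexx orbT.
Qed.
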